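(* Let $k\geq 1$ be an integer, let $\alpha$ be an integer with $0\leq\alpha\leq k-1$, and let $\tau=\tau(\alpha,k-1-\alpha)$ be the hooktype of hooks with armlength $\alpha$ and leglength $k-1-\alpha$ (hence of length $k$). Then, as formal power series in $z$, $$\sum_{n=1}^\infty \tau(n)\,z^n=\frac{z^k}{1-z^k}\prod_{i=1}^\infty\frac{1}{1-z^i}=\sum_{\lambda=1^{\nu_1}2^{\nu_2}\cdots}\nu_k\,z^{\vert\lambda\vert},$$ where the last sum is over all partitions $\lambda$ of integers and $\nu_k$ is the number of parts of $\lambda$ equal to $k$.
   Context: A partition of a natural integer $n$ is a finite decreasing sequence $\lambda=(\lambda_1\geq\lambda_2\geq\dots\geq\lambda_s>0)$ of positive integers (its parts) with $\sum_i\lambda_i=n$; its content is $\vert\lambda\vert=n$. One also writes $\lambda=1^{\nu_1}2^{\nu_2}\cdots$, where $\nu_i$ is the number of parts of $\lambda$ equal to $i$. The Young diagram of $\lambda$ consists of left-aligned rows of boxes, with $\lambda_1$ boxes in the first (top) row, $\lambda_2$ boxes in the second row, and so on. A hook in $\lambda$ is a choice of a box $H$ of the Young diagram together with all boxes to the right of $H$ in the same row and all boxes below $H$ in the same column. The length of the hook is its total number of boxes; its armlength is the number of its boxes to the right of $H$, and its leglength is the number of its boxes below $H$. The hooktype of a hook is the couple (armlength, leglength); $\tau(\alpha,k-1-\alpha)$ denotes the hooktype with armlength $\alpha$ and leglength $k-1-\alpha$. For a hooktype $\tau$ and a partition $\lambda$, $\tau(\lambda)$ denotes the number of hooks of type $\tau$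 in the Young diagram of $\lambda$, and $\tau(n)=\sum_{\lambda,\ \vert\lambda\vert=n}\tau(\lambda)$, the sum being over all partitions of $n$. *)

(* Defs.v *)
From HB Require Import structures.
From mathcomp Require Import all_boot all_order all_algebra.
From mathcomp Require Import boolp classical_sets.

Set Implicit Arguments.
Unset Strict Implicit.
Unset Printing Implicit Defensive.

Import GRing.Theory.
Local Open Scope ring_scope.

(* Formal power series over a commutative ring, as coefficient sequences. *)

Record fps (R : comNzRingType) := Fps { fps_coef : nat -> R }.

Notation "{ 'fps' R }" := (fps R) (format "{ 'fps'  R }") : type_scope.

Section FpsRing.
Variable R : comNzRingType.
Implicit Types f g h : {fps R}.

Lemma fpsP f g : (forall n, fps_coef f n = fps_coef g n) -> f = g.
Proof. by case: f g => f [g] /= fg; congr Fps; apply/funext. Qed.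

HB.instance Definition _ := gen_eqMixin {fps R}.
HB.instance Definition _ := gen_choiceMixin {fps R}.

Definition fps_zero : {fps R} := Fps (fun=> 0).
Definition fps_opp f : {fps R} := Fps (fun n => - fps_coef f n).
Definition fps_add f g : {fps R} := Fps (fun n => fps_coef f n + fps_coef g n).
Definition fps_one : {fps R} := Fps (fun n => (n == 0%N)%:R).
Definition fps_mul f g : {fps R} :=
  Fps (fun n => \sum_(i < n.+1) fps_coef f i * fps_coef g (n - i)).

Fact fps_addA : associative fps_add.
Proof. by move=> f g h; apply/fpsP => n /=; rewrite addrA. Qed.
Fact fps_addC : commutative fps_add.
Proof. by move=> f g; apply/fpsP => n /=; rewrite addrC. Qed.
Fact fps_add0 : left_id fps_zero fps_add.
Proof. by move=> f; apply/fpsP => n /=; rewrite add0r. Qed.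
Fact fps_addN : left_inverse fps_zero fps_opp fps_add.
Proof. by move=> f; apply/fpsP => n /=; rewrite addNr. Qed.

HB.instance Definition _ :=
  GRing.isZmodule.Build {fps R} fps_addA fps_addC fps_add0 fps_addN.

Definition fps_trunc n f : {poly R} := \poly_(i < n.+1) fps_coef f i.

Lemma coef_fps_trunc n f i :
  (i <= n)%N -> (fps_trunc n f)`_i = fps_coef f i.
Proof. by move=> le_in; rewrite coef_poly ltnS le_in. Qed.

Lemma fps_mulE N f g n : (n <= N)%N ->
  fps_coef (fps_mul f g) n = (fps_trunc N f * fps_trunc N g)`_n.
Proof.
move=> le_nN; rewrite coefM; apply: eq_bigr => i _.
by rewrite !coef_fps_trunc // (leq_trans _ le_nN) // ?leq_subr // -ltnS.
Qed.

Fact fps_mulA : associative fps_mul.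
Proof.
move=> f g h; apply/fpsP => n.
have -> : fps_coef (fps_mul f (fps_mul g h)) n
        = (fps_trunc n f * (fps_trunc n g * fps_trunc n h))`_n.
  rewrite coefM; apply: eq_bigr => i _.
  rewrite coef_fps_trunc -1?ltnS //; congr (_ * _).
  by rewrite (fps_mulE (N := n)) // leq_subr.
rewrite mulrA coefM; apply: eq_bigr => i _.
rewrite coef_fps_trunc ?leq_subr //; congr (_ * _).
by rewrite (fps_mulE (N := n)) // -ltnS.
Qed.

Fact fps_mulC : commutative fps_mul.
Proof. by move=> f g; apply/fpsP => n; rewrite !(fps_mulE (N := n)) // mulrC. Qed.

Fact fps_mul1 : left_id fps_one fps_mul.
Proof.
move=> f; apply/fpsP => n /=; rewrite big_ord_recl /= mul1r subn0.
by rewrite big1 ?addr0 // => i _; rewrite mul0r.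
Qed.

Fact fps_mulDl : left_distributive fps_mul fps_add.
Proof.
move=> f g h; apply/fpsP => n /=; rewrite -big_split /=.
by apply: eq_bigr => i _; rewrite mulrDl.
Qed.

Fact fps_one_neq0 : fps_one != 0.
Proof.
by apply/eqP => /(congr1 (fun f => fps_coef f 0)) /eqP; rewrite /= oner_eq0.
Qed.

HB.instance Definition _ := GRing.Zmodule_isComNzRing.Build {fps R}
  fps_mulA fps_mulC fps_mul1 fps_mulDl fps_one_neq0.

Definition fps_unit : {pred {fps R}} := fun f => `[< exists g, g * f = 1 >].

(* As required by [comUnitRingType], [f^-1] is [f] for non-invertible [f]. *)
Definition fps_inv f : {fps R} := xget f [set g | g * f = 1].

Fact fps_mulV : {in fps_unit, left_inverse 1 fps_inv *%R}.
Proof.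
move=> f /asboolP[g gf1].
by apply: (@xgetPex _ f [set h | h * f = 1]%classic); exists g.
Qed.

Fact fps_unitPl f g : g * f = 1 -> fps_unit f.
Proof. by move=> gf1; apply/asboolP; exists g. Qed.

Fact fps_inv_out : {in [predC fps_unit], fps_inv =1 id}.
Proof.
move=> f /asboolPn nuf; apply: xgetPN => g gf1.
by apply: nuf; exists g.
Qed.

HB.instance Definition _ := GRing.ComNzRing_hasMulInverse.Build {fps R}
  fps_mulV fps_unitPl fps_inv_out.

Definition fpsX : {fps R} := Fps (fun n => (n == 1%N)%:R).

(* Convergence for the usual topology on formal power series (the product of
   the discrete topologies): every coefficient is eventually constant. *)
Definition fps_limit (u : nat -> {fps R}) f :=
  forall n, exists N, forall m, (N <= m)%N -> fps_coef (u m) n = fps_coef f n.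

(* Sums and products over the integers [i >= 1]. *)
Definition fps_series1 (u : nat -> {fps R}) f :=
  fps_limit (fun m => \sum_(1 <= i < m.+1) u i) f.
Definition fps_product1 (u : nat -> {fps R}) f :=
  fps_limit (fun m => \prod_(1 <= i < m.+1) u i) f.

(* Unordered sum of a family: the net of finite partial sums converges. *)
Definition fps_family_sum (I : eqType) (u : I -> {fps R}) f :=
  forall n, exists s0 : seq I, forall s : seq I,
    uniq s -> {subset s0 <= s} ->
    fps_coef (\sum_(i <- s) u i) n = fps_coef f n.

End FpsRing.

Local Open Scope nat_scope.

Record intpartition := IntPartition {
  parts :> seq nat;
  partsP : sorted geq parts && (0 \notin parts)
}.

HB.instance Definition _ := [isSub for parts].
HB.instance Definition _ := [Countable of intpartition by <:].

Definition content (lam : intpartition) : nat := sumn lam.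

Definition multiplicity (i : nat) (lam : intpartition) : nat := count_mem i lam.

Record intpartition_of (n : nat) := IntPartitionOf {
  intpartition_val :> intpartition;
  intpartition_valP : content intpartition_val == n
}.

HB.instance Definition _ n := [isSub for @intpartition_val n].
HB.instance Definition _ n := [Countable of intpartition_of n by <:].

Section IntPartitionOfFinite.
Variable n : nat.

Definition bseq_of_intpartition (p : intpartition_of n) : n.-bseq 'I_n.+1 :=
  insub_bseq n (map inord (val p)).

Definition intpartition_of_bseq (b : n.-bseq 'I_n.+1) : option (intpartition_of n) :=
  obind insub (insub (map val b) : option intpartition).

Lemma leq_size_sumn s : 0 \notin s -> size s <= sumn s.
Proof.
elim: s => //= x s IHs; rewrite inE negb_or => /andP[x_neq0 /IHs le_s].
by rewrite -add1n leq_add // lt0n eq_sym.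
Qed.

Lemma leq_mem_sumn x s : x \in s -> x <= sumn s.
Proof.
elim: s => //= y s IHs; rewrite inE => /predU1P[->|/IHs le_x].
  exact: leq_addr.
exact: leq_trans le_x (leq_addl _ _).
Qed.

Lemma bseq_of_intpartitionK : pcancel bseq_of_intpartition intpartition_of_bseq.
Proof.
case=> lam lam_n; rewrite /intpartition_of_bseq /bseq_of_intpartition /=.
have sum_lam : sumn lam = n by exact/eqP.
have size_lam : size (map (@inord n) lam) <= n.
  by rewrite size_map -[leqRHS]sum_lam leq_size_sumn //; case/andP: (partsP lam).
have -> : map val (insub_bseq n (map (@inord n) lam)) = lam :> seq nat.
  rewrite [bseqval _]insubdK // -map_comp map_id_in // => x /leq_mem_sumn.
  by rewrite sum_lam /= => le_xn; rewrite inordK.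
by rewrite (valK lam) /= insubT.
Qed.

HB.instance Definition _ : isFinite (intpartition_of n) :=
  PCanIsFinite bseq_of_intpartitionK.

End IntPartitionOfFinite.

(* The box [(i, j)] lies in row [i] (counted from the top) and column [j]
   (counted from the left), both starting at 0. *)
Definition young_diagram (lam : intpartition) : seq (nat * nat) :=
  [seq (i, j) | i <- iota 0 (size lam), j <- iota 0 (nth 0 lam i)].

Definition armlength (lam : intpartition) (H : nat * nat) : nat :=
  count (fun B => (B.1 == H.1) && (H.2 < B.2)) (young_diagram lam).

Definition leglength (lam : intpartition) (H : nat * nat) : nat :=
  count (fun B => (B.2 == H.2) && (H.1 < B.1)) (young_diagram lam).

(* A hook is determined by its corner box [H]. *)
Definition hooktype (lam : intpartition) (H : nat * nat) : nat * nat :=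
  (armlength lam H, leglength lam H).

Definition hook_count (tau : nat * nat) (lam : intpartition) : nat :=
  count (fun H => hooktype lam H == tau) (young_diagram lam).

Definition hook_total (tau : nat * nat) (n : nat) : nat :=
  \sum_(lam : intpartition_of n) hook_count tau (val lam).

(* Main.v *)
Require Import Defs.
From mathcomp Require Import all_boot all_order all_algebra.
From mathcomp Require Import zify.
From mathcomp Require Import boolp.
Local Open Scope ring_scope.

Import GRing.Theory.

Set Implicit Arguments.
Unset Strict Implicit.
Unset Printing Implicit Defensive.

(** Let [h n] be the number of hooks of type [(a, l)] in all partitions of
    [n], let [p n] be the number of these partitions, and let [k = a + l + 1].
    Everything follows from the recurrence [h (n + k) = h n + p n], together
    with [h n = 0] for [n < k] ([hook_total_rec], [hook_total_small]).  On
    generating series it reads [(1 - z ^ k) H = z ^ k P], where [P] is Euler's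
    product ([fps_recurrence], [partition_series_product]).  The total number
    of parts equal to [k] satisfies the same recurrence, since deleting one
    part [k] is a bijection from the partitions of [n + k] having such a part
    to the partitions of [n] ([multiplicity_total_rec]).

    The recurrence for [h] has two ingredients.  Deleting the rim hook
    attached to a hook of type [(a, l)] turns a partition of [n + k] with a
    marked hook into a partition of [n] with a marked place where a rim hook
    of that shape can be added, and this is a bijection
    ([sum_hook_addable]).  Moreover every partition has exactly one more such
    place than it has hooks of type [(a, l)] ([sum_addable]).  To see this,
    read the boundary of the diagram as a two-sided sequence of unit steps,
    all of one kind far on one side and all of the other kind far on the other
    side, and slide along it a window of [k] consecutive steps.  The number of
    horizontal steps in the window goes from [0] to [k], or from [k] to [0] in
    the other direction, changing by at most one at each move; moves between
    [a] and [a + 1] in one direction are the hooks of type [(a, l)], those in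
    the other direction are the places for an addition, and the two numbers
    differ by one because the walk starts and ends on different sides.

    The formal argument works with the row lengths [f 0 >= f 1 >= ...],
    extended by zeros, in which both conditions become inequalities between
    [f i], [f (i + l)] and a neighbouring row ([hook_at], [addable_at]). *)

Local Open Scope nat_scope.

(** * Rows of a partition *)

Lemma sumn_rows (s : seq nat) N :
  size s <= N -> sumn s = \sum_(0 <= j < N) nth 0 s j.
Proof.
move=> le_sN; rewrite sumnE (big_nth 0) (@big_cat_nat _ _ _ (size s) 0 N) //=.
rewrite [X in _ + X]big_nat_cond [X in _ + X]big1 ?addn0 // => j.
by rewrite andbT => /andP[le_j _]; rewrite nth_default.
Qed.

Lemma sumn_filter_neq0 (s : seq nat) : sumn [seq x <- s | x != 0] = sumn s.
Proof. by elim: s => //= -[|x] s /= ->. Qed.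

Lemma geq_trans : transitive geq.
Proof. by move=> y x z /= le_yx le_zy; apply: leq_trans le_zy le_yx. Qed.

Lemma geq_anti : antisymmetric geq.
Proof. by move=> x y /= /andP[le_yx le_xy]; apply/anti_leq/andP. Qed.

Lemma antitone_leq (f : nat -> nat) :
  (forall j, f j.+1 <= f j) -> forall x y, x <= y -> f y <= f x.
Proof.
move=> f_dec x y /subnKC <-; elim: (y - x) => [|d IHd]; first by rewrite addn0.
by rewrite addnS (leq_trans (f_dec _)).
Qed.

Lemma rows_antitone (lam : intpartition) x y :
  x <= y -> nth 0 lam y <= nth 0 lam x.
Proof.
move=> le_xy; have /andP[sorted_lam _] := partsP lam.
have [lt_y|le_y] := ltnP y (size lam); last by rewrite [leqLHS]nth_default.
have geq_refl : reflexive geq by move=> z /=.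
by apply: (sorted_leq_nth geq_trans geq_refl 0 sorted_lam);
   rewrite ?inE ?(leq_ltn_trans le_xy).
Qed.

Lemma rows_inj (lam mu : intpartition) :
  (forall i, nth 0 lam i = nth 0 mu i) -> lam = mu.
Proof.
have size_rows (nu : intpartition) i : (i < size nu) = (nth 0 nu i != 0).
  have /andP[_ nu0] := partsP nu; case: ltnP => [lt_i|le_i].
    by apply/esym; apply: contraNneq nu0 => <-; apply: mem_nth.
  by rewrite nth_default.
move=> eq_rows; apply: val_inj; apply: (@eq_from_nth _ 0) => [|i _] //.
have eq_lt i : (i < size lam) = (i < size mu) by rewrite !size_rows eq_rows.
by move: (eq_lt (size lam)) (eq_lt (size mu)) => /=; lia.
Qed.

Lemma perm_partition (lam mu : intpartition) : perm_eq lam mu -> lam = mu.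
Proof.
move=> eq_lm; apply: val_inj; apply: (sorted_eq geq_trans geq_anti) => //.
- by have /andP[] := partsP lam.
- by have /andP[] := partsP mu.
Qed.

Lemma size_partition n (lam : intpartition_of n) : size lam <= n.
Proof.
have /andP[_ lam0] := partsP lam.
by rewrite -[leqRHS](eqP (intpartition_valP lam)) leq_size_sumn.
Qed.

Lemma sumn_partition n (lam : intpartition_of n) : sumn lam = n.
Proof. exact/eqP/(intpartition_valP lam). Qed.

Lemma seq_partition_subproof (s : seq nat) :
  let t := sort geq [seq x <- s | x != 0] in sorted geq t && (0 \notin t).
Proof.
rewrite /= sort_sorted => [|x y]; last exact: leq_total.
by rewrite mem_sort mem_filter.
Qed.

Definition seq_partition s : intpartition :=
  IntPartition (seq_partition_subproof s).

Lemma content_seq_partition s : content (seq_partition s) = sumn s.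
Proof.
rewrite /content -[RHS]sumn_filter_neq0; apply: perm_sumn.
by apply/permPl/perm_sort.
Qed.

Lemma ones_subproof n : content (seq_partition (nseq n 1)) == n.
Proof. by rewrite content_seq_partition sumn_nseq mul1n. Qed.

(** The partition [1^n] is only a default value, for lists [s] whose sum is
    not [n]. *)
Definition partition_of_seq n s : intpartition_of n :=
  insubd (IntPartitionOf (ones_subproof n)) (seq_partition s).

Lemma perm_partition_of_seq n s :
  sumn s = n -> perm_eq (partition_of_seq n s) [seq x <- s | x != 0].
Proof.
move=> sum_s; rewrite [intpartition_val _]insubdK /=.
  by apply/permPl/perm_sort.
by rewrite -topredE /= content_seq_partition sum_s.
Qed.

(** The zeros of a nonincreasing list are at its end. *)
Lemma nth_filter_neq0 (s : seq nat) i :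
  sorted geq s -> nth 0 [seq x <- s | x != 0] i = nth 0 s i.
Proof.
elim: s i => //= x s IHs i sorted_xs.
have {}IHs j := IHs j (path_sorted sorted_xs).
have [x0|_] := eqVneq x 0; last by case: i => //= i.
have s0 y : y \in s -> y = 0.
  move: sorted_xs; rewrite x0 (path_sortedE geq_trans) => /andP[/allP s0 _].
  by move/s0 => /=; rewrite leqn0 => /eqP.
have nth_s j : nth 0 s j = 0.
  by case: (ltnP j (size s)) => [/(mem_nth 0)/s0 //|/(nth_default 0)].
by rewrite IHs; case: i => [|i] /=; rewrite nth_s ?x0.
Qed.

Lemma rows_partition_of_seq n N (f : nat -> nat) :
    (forall j, f j.+1 <= f j) -> (forall j, N <= j -> f j = 0) ->
    \sum_(0 <= j < N) f j = n ->
  forall j, nth 0 (partition_of_seq n (mkseq f N)) j = f j.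
Proof.
move=> f_dec f0 sum_f j.
have sorted_f : sorted geq (mkseq f N).
  by apply: homo_sorted (iota_sorted 0 N) => x y; apply: antitone_leq.
have sumn_f : sumn (mkseq f N) = n.
  by rewrite -sum_f sumnE big_map /index_iota subn0.
suff -> : parts (partition_of_seq n (mkseq f N))
    = [seq x <- mkseq f N | x != 0].
  rewrite nth_filter_neq0 //; case: (ltnP j N) => [/(nth_mkseq 0) //|le_Nj].
  by rewrite nth_default ?size_mkseq // f0.
apply: (sorted_eq geq_trans geq_anti); last exact: perm_partition_of_seq.
- by have /andP[] := partsP (partition_of_seq n (mkseq f N)).
- exact: (sorted_filter geq_trans).
Qed.

(** * Hooks read off from the rows *)

Lemma sum_between N i h :
  \sum_(0 <= r < N) ((i < r) && (r < h)) = minn N h - i.+1.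
Proof.
elim: N => [|N IHN]; first by rewrite big_geq // min0n.
by rewrite big_nat_recr //= IHN; case: (ltnP i N); case: (ltnP N h); lia.
Qed.

Lemma sum_nat_pred1 N i (F : nat -> nat) :
  \sum_(0 <= r < N) (r == i) * F r = (i < N) * F i.
Proof.
elim: N => [|N IHN]; first by rewrite big_geq.
rewrite big_nat_recr //= IHN ltnS [i <= N]leq_eqVlt eq_sym.
by case: eqP => [->|_] /=; rewrite ?ltnn ?addn0 ?mul0n ?addn0.
Qed.

Lemma count_young_diagram (lam : intpartition) (a : pred (nat * nat)) N :
  size lam <= N ->
  count a (young_diagram lam)
  = \sum_(0 <= r < N) \sum_(0 <= c < nth 0 lam r) a (r, c).
Proof.
move=> le_N; rewrite -sum1_count big_mkcond /= big_allpairs_dep /=.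
rewrite [RHS](@big_cat_nat _ _ _ (size lam) 0 N) //=.
rewrite [X in _ = _ + X]big_nat_cond [X in _ = _ + X]big1 ?addn0.
  rewrite /index_iota subn0; apply: eq_bigr => r _; rewrite subn0.
  by apply: eq_bigr => c _; case: (a _).
by move=> r; rewrite andbT => /andP[le_r _]; rewrite nth_default // big_geq.
Qed.

Lemma armlengthE (lam : intpartition) i j :
  armlength lam (i, j) = nth 0 lam i - j.+1.
Proof.
rewrite /armlength (count_young_diagram _ (leq_maxl (size lam) i.+1)) /=.
transitivity (\sum_(0 <= r < maxn (size lam) i.+1)
                (r == i) * \sum_(0 <= c < nth 0 lam r)
                             ((j < c) && (c < nth 0 lam r))).
  apply: eq_bigr => r _; rewrite big_distrr /=.
  apply: eq_big_nat => c /andP[_ ->]; rewrite andbT.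
  by case: (r == i); rewrite ?mul1n.
by rewrite sum_nat_pred1 leq_maxr mul1n sum_between minnn.
Qed.

Lemma leglengthE (lam : intpartition) i j N : size lam <= N ->
  leglength lam (i, j) = \sum_(0 <= r < N) ((i < r) && (j < nth 0 lam r)).
Proof.
move=> le_N; rewrite /leglength (count_young_diagram _ le_N) /=.
apply: eq_bigr => r _.
transitivity (\sum_(0 <= c < nth 0 lam r) (c == j) * (i < r)).
  by apply: eq_bigr => c _; case: (c == j); case: (i < r).
rewrite (sum_nat_pred1 _ _ (fun _ => (i < r) : nat)) mulnC.
by case: (i < r); case: (j < _).
Qed.

(** The leg under a box of column [j] stops where that column does, so its
    length is read off from the two rows around its end. *)
Lemma leglength_eq (lam : intpartition) i j l : j < nth 0 lam i ->
  (leglength lam (i, j) == l) =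
  (j < nth 0 lam (i + l)) && (nth 0 lam (i + l).+1 <= j).
Proof.
move=> lt_j; rewrite (leglengthE _ _ (leqnn _)).
have ex_end : exists h, nth 0 lam h <= j.
  by exists (size lam); rewrite nth_default.
case: (ex_minnP ex_end) => h end_h min_h.
have colE r : (j < nth 0 lam r) = (r < h).
  apply/idP/idP => [|lt_rh]; last by rewrite ltnNge; apply/negP => /min_h; lia.
  apply: contraLR; rewrite -!leqNgt => /(rows_antitone lam).
  by move/leq_trans; apply.
have le_h : h <= size lam by apply: min_h; rewrite nth_default.
under eq_bigr => r _ do rewrite colE.
rewrite sum_between (minn_idPr le_h) [nth _ _ _ <= j]leqNgt !colE.
by move: lt_j; rewrite colE; lia.
Qed.

(** The end of row [i] carries a hook of arm [a] and leg [l]. *)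
Definition hook_at a l (f : nat -> nat) i :=
  (f (i + l).+1 + a < f i) && (f i <= f (i + l) + a).

(** A hook of arm [a] and leg [l] can be added so that it occupies the rows
    [i] to [i + l]. *)
Definition addable_at a l (f : nat -> nat) i :=
  (f i <= f (i + l) + a) && ((i == 0) || (f (i + l) + a < f i.-1)).

(** A row has at most one box with arm [a], the one in column [f i - a.+1], so
    the hooks of a given type are counted by rows. *)
Lemma hook_countE a l (lam : intpartition) N : size lam <= N ->
  hook_count (a, l) lam = \sum_(0 <= i < N) hook_at a l (nth 0 lam) i.
Proof.
move=> le_N; rewrite /hook_count (count_young_diagram _ le_N).
apply: eq_bigr => i _; rewrite /hooktype /hook_at.
transitivity (\sum_(0 <= j < nth 0 lam i)
                (j == nth 0 lam i - a.+1) *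
                ((a < nth 0 lam i) && (leglength lam (i, j) == l))).
  apply: eq_big_nat => j /andP[_ lt_j]; rewrite xpair_eqE armlengthE mulnb.
  by congr nat_of_bool; rewrite andbA; congr (_ && _); lia.
rewrite (sum_nat_pred1 _ _
           (fun j => ((a < _) && (leglength lam (i, j) == l) : nat))).
case: (ltnP a (nth 0 lam i)) => [lt_a|le_a] /=; last by rewrite muln0; lia.
have lt_row : nth 0 lam i - a.+1 < nth 0 lam i by lia.
by rewrite leglength_eq // lt_row mul1n; congr nat_of_bool; lia.
Qed.

(** * Hooks against addable hooks *)

(** Write [d i] for [f i <= f (i + l) + a] and [e i] for
    [f (i + l).+1 + a < f i].  A hook at [i] means [d i] and [e i]; an addable
    one means [d i] and [e i.-1], with [e] true before row [0].  If [e i] fails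
    then both [d i] and [d i.+1] hold, so each count is the number of [d]'s
    minus the number of failures of [e], and the shift by one spares the
    second count the failure of [e] in the last row. *)
Lemma sum_addable a l (f : nat -> nat) N :
    (forall j, f j.+1 <= f j) -> f N = 0 ->
  \sum_(0 <= i < N.+1) addable_at a l f i
  = (\sum_(0 <= i < N.+1) hook_at a l f i).+1.
Proof.
move=> f_dec fN.
have partial m : \sum_(0 <= i < m.+1) addable_at a l f i
    = \sum_(0 <= i < m.+1) hook_at a l f i + (f m <= f (m + l).+1 + a).
  elim: m => [|m IHm]; last first.
    rewrite big_nat_recr // [in RHS]big_nat_recr //= IHm.
    rewrite /addable_at /hook_at /=.
    have := f_dec m; have := f_dec (m + l).+1; rewrite !addSn; lia.
  rewrite !big_nat1 /addable_at /hook_at /= add0n.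
  by have := f_dec l; lia.
by rewrite partial fN addn1.
Qed.

(** * Removing and adding a hook *)

(** Deletion of the rim hook from the end of row [i] down to row [i + l]: each
    of the rows [i.+1] to [i + l] loses one box and moves up, while row [i]
    loses [a.+1] boxes, an arm and its corner, and moves down to place
    [i + l]. *)
Definition remove_hook a l i (f : nat -> nat) j :=
  if j < i then f j
  else if j < i + l then f j.+1 - 1
  else if j == i + l then f i - a.+1
  else f j.

Definition add_hook a l i (f : nat -> nat) j :=
  if j < i then f j
  else if j == i then f (i + l) + a.+1
  else if j <= i + l then f j.-1 + 1
  else f j.

(** On rows [i] to [i + l] the new lengths are the old ones shifted by one
    place, each with one box more, except that the last old row comes first
    with [a.+1] more boxes. *)
Lemma sum_add_hook a l i (f : nat -> nat) N : i + l < N ->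
  \sum_(0 <= j < N) add_hook a l i f j = \sum_(0 <= j < N) f j + (a + l).+1.
Proof.
move=> lt_N.
have split (F : nat -> nat) : \sum_(0 <= j < N) F j
    = \sum_(0 <= j < i) F j + \sum_(0 <= t < l.+1) F (t + i)
      + \sum_((i + l).+1 <= j < N) F j.
  rewrite (@big_cat_nat _ _ _ (i + l).+1 0 N) //.
  rewrite (@big_cat_nat _ _ _ i) //=; last lia.
  rewrite -[X in \sum_(X <= j < (i + l).+1) F j]add0n big_addn.
  by congr (_ + \sum_(0 <= j < _) _ + _); lia.
rewrite !split.
have -> : \sum_(0 <= j < i) add_hook a l i f j = \sum_(0 <= j < i) f j.
  by apply: eq_big_nat => j /andP[_ lt_ji]; rewrite /add_hook lt_ji.
have -> : \sum_((i + l).+1 <= j < N) add_hook a l i f j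
    = \sum_((i + l).+1 <= j < N) f j.
  apply: eq_big_nat => j /andP[lt_j _]; rewrite /add_hook.
  by do ?case: ifP; lia.
suff -> : \sum_(0 <= t < l.+1) add_hook a l i f (t + i)
    = \sum_(0 <= t < l.+1) f (t + i) + (a + l).+1 by lia.
rewrite big_nat_recl // big_nat_recr //= add0n.
have -> : add_hook a l i f i = f (i + l) + a.+1 by rewrite /add_hook ltnn eqxx.
have -> : \sum_(0 <= t < l) add_hook a l i f (t.+1 + i)
    = \sum_(0 <= t < l) (f (t + i) + 1).
  apply: eq_big_nat => t /andP[_ lt_tl]; rewrite /add_hook addSn /=.
  by do ?case: ifP; lia.
by rewrite big_split /= sum_nat_const_nat (addnC l i); lia.
Qed.

Section HookMoves.
Variables (a l i : nat) (f : nat -> nat).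
Hypothesis f_dec : forall j, f j.+1 <= f j.

Let f_le x y : x <= y -> f y <= f x. Proof. exact: antitone_leq. Qed.

Lemma remove_hook_dec j : hook_at a l f i ->
  remove_hook a l i f j.+1 <= remove_hook a l i f j.
Proof.
case/andP=> lt_end le_arm; rewrite /remove_hook.
have := f_dec j; have := f_dec j.+1.
have [->|] := eqVneq j (i + l).
  by do ?case: ifP; lia.
have [->|] := eqVneq j.+1 (i + l).
  by do ?case: ifP; lia.
have [<-|] := eqVneq j.+1 i; last by do ?case: ifP; lia.
by do ?case: ifP; lia.
Qed.

Lemma remove_hook_addable :
  hook_at a l f i -> addable_at a l (remove_hook a l i f) i.
Proof.
case/andP=> lt_end le_arm; rewrite /addable_at /remove_hook.
have := f_dec i; have := f_dec i.-1.
by case: (i) lt_end le_arm => [|i'] /= *; do ?case: ifP; lia.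
Qed.

Lemma remove_hookK : hook_at a l f i ->
  forall j, add_hook a l i (remove_hook a l i f) j = f j.
Proof.
case/andP=> lt_end le_arm j; rewrite /add_hook /remove_hook.
have [->|ne_ji] := eqVneq j i; first by do ?case: ifP; lia.
have [le_j|lt_j] := leqP j (i + l); last by do ?case: ifP; lia.
have := f_le le_j.
case: j ne_ji le_j => [|j] ne_ji le_j /=; by do ?case: ifP; lia.
Qed.

Lemma add_hook_dec j : addable_at a l f i ->
  add_hook a l i f j.+1 <= add_hook a l i f j.
Proof.
case/andP=> le_new lt_prev; rewrite /add_hook /=.
have := f_dec j; have := f_le (leq_pred j).
move: le_new lt_prev; have [<-|] := eqVneq j.+1 i.
  by move=> /= le_new lt_prev; do ?case: ifP; lia.
have [->|] := eqVneq j i.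
  by do ?case: ifP; lia.
by do ?case: ifP; lia.
Qed.

Lemma add_hook_hook : addable_at a l f i -> hook_at a l (add_hook a l i f) i.
Proof.
case/andP=> le_new lt_prev; rewrite /hook_at /add_hook /=.
have := f_dec (i + l).
case: (posnP l) le_new => [->|l_gt0] le_new.
  by rewrite !addn0 in le_new *; do ?case: ifP; lia.
have := @f_le (i + l).-1 (i + l) (leq_pred _).
by do ?case: ifP; lia.
Qed.

Lemma add_hookK : forall j, remove_hook a l i (add_hook a l i f) j = f j.
Proof.
move=> j; rewrite /add_hook /remove_hook /=.
have [->|ne_j] := eqVneq j (i + l); last by do ?case: ifP; lia.
by do ?case: ifP; lia.
Qed.

End HookMoves.

Lemma sum_rows n (lam : intpartition_of n) N : n <= N ->
  \sum_(0 <= j < N) nth 0 lam j = n.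
Proof.
move=> le_n; rewrite -sumn_rows ?sumn_partition //.
exact: leq_trans (size_partition lam) le_n.
Qed.

Lemma row_default n (lam : intpartition_of n) j : n <= j -> nth 0 lam j = 0.
Proof.
by move=> le_n; rewrite nth_default // (leq_trans (size_partition lam)).
Qed.

(** The row in which the leg ends is not empty. *)
Lemma hook_at_lt a l n (lam : intpartition_of n) i :
  hook_at a l (nth 0 lam) i -> i + l < n.
Proof.
case/andP=> lt_end le_arm; rewrite ltnNge; apply/negP => le_n.
by move: le_arm lt_end; rewrite (row_default lam le_n); lia.
Qed.

Lemma sum_remove_hook a l n (lam : intpartition_of n) i N : n <= N ->
    hook_at a l (nth 0 lam) i ->
  \sum_(0 <= j < N) remove_hook a l i (nth 0 lam) j + (a + l).+1 = n.
Proof.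
move=> le_n hook_i; have lt_i := hook_at_lt hook_i.
rewrite -(@sum_add_hook _ _ i) ?(leq_trans lt_i) // -[RHS](sum_rows lam le_n).
apply: eq_big_nat => j _; apply: remove_hookK => // x.
exact: rows_antitone.
Qed.

(** Deletion and addition of a rim hook on the rows [i] to [i + l] are inverse
    bijections between the partitions counted on either side. *)
Lemma sum_hook_addable a l n i :
  \sum_(lam : intpartition_of (n + (a + l).+1)) hook_at a l (nth 0 lam) i
  = \sum_(mu : intpartition_of n) addable_at a l (nth 0 mu) i.
Proof.
(* Any bound above [i + l] and above the numbers of rows would do. *)
set N := (i + l + n + (a + l).+1).+1.
pose add (mu : intpartition_of n) : intpartition_of (n + (a + l).+1) :=
  partition_of_seq _ (mkseq (add_hook a l i (nth 0 mu)) N).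
pose del (lam : intpartition_of (n + (a + l).+1)) : intpartition_of n :=
  partition_of_seq _ (mkseq (remove_hook a l i (nth 0 lam)) N).
have row_dec (lam : intpartition) j : nth 0 lam j.+1 <= nth 0 lam j.
  exact: rows_antitone.
have rows_add (mu : intpartition_of n) : addable_at a l (nth 0 mu) i ->
    nth 0 (add mu) = add_hook a l i (nth 0 mu).
  move=> add_i; apply/funext; apply: rows_partition_of_seq => [j|j le_j|].
  - by apply: add_hook_dec.
  - rewrite /add_hook (row_default mu); last by rewrite /N in le_j; lia.
    by do ?case: ifP; rewrite /N in le_j; lia.
  - by rewrite sum_add_hook ?sum_rows /N //; lia.
have rows_del (lam : intpartition_of (n + (a + l).+1)) :
    hook_at a l (nth 0 lam) i ->
    nth 0 (del lam) = remove_hook a l i (nth 0 lam).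
  move=> hook_i; apply/funext; apply: rows_partition_of_seq => [j|j le_j|].
  - by apply: remove_hook_dec.
  - rewrite /remove_hook (row_default lam); last by rewrite /N in le_j; lia.
    by do ?case: ifP; rewrite /N in le_j; lia.
  - apply/eqP; rewrite -(eqn_add2r (a + l).+1) (sum_remove_hook _ hook_i) //.
    by rewrite /N; lia.
have hook_add (mu : intpartition_of n) :
    addable_at a l (nth 0 mu) i -> hook_at a l (nth 0 (add mu)) i.
  by move=> add_i; rewrite rows_add //; apply: add_hook_hook.
have addable_del (lam : intpartition_of (n + (a + l).+1)) :
    hook_at a l (nth 0 lam) i -> addable_at a l (nth 0 (del lam)) i.
  by move=> hook_i; rewrite rows_del //; apply: remove_hook_addable.
have delK (lam : intpartition_of (n + (a + l).+1)) :
    hook_at a l (nth 0 lam) i -> add (del lam) = lam.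
  move=> hook_i; apply/val_inj/rows_inj => j /=.
  by rewrite rows_add ?addable_del // rows_del //; apply: remove_hookK.
have addK (mu : intpartition_of n) :
    addable_at a l (nth 0 mu) i -> del (add mu) = mu.
  move=> add_i; apply/val_inj/rows_inj => j /=.
  by rewrite rows_del ?hook_add // rows_add //; apply: add_hookK.
transitivity (\sum_(lam : intpartition_of (n + (a + l).+1)
                    | hook_at a l (nth 0 lam) i) 1).
  by rewrite [RHS]big_mkcond; apply: eq_bigr => lam _; case: (hook_at _ _ _ _).
rewrite (reindex_onto add del) //= [LHS]big_mkcond; apply: eq_bigr => mu _.
have [add_i|nadd_i] := boolP (addable_at a l (nth 0 mu) i).
  by rewrite hook_add ?addK ?eqxx.
case: ifP => // /andP[hook_i /eqP mu_eq].
by case/negP: nadd_i; rewrite -mu_eq addable_del.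
Qed.

(** The bijection is applied row by row: the hooks of the partitions of
    [n + (a + l).+1] become the addable hooks of the partitions of [n], and
    each of the latter partitions has one more of these than hooks. *)
Lemma hook_total_rec a l n :
  hook_total (a, l) (n + (a + l).+1)
  = hook_total (a, l) n + #|{: intpartition_of n}|.
Proof.
rewrite /hook_total; set N := n + (a + l).+1.
have le_N m (lam : intpartition_of m) : m <= N -> size lam <= N.+1.
  by move=> le_m; rewrite (leq_trans (size_partition lam)) // leqW.
transitivity (\sum_(mu : intpartition_of n)
                \sum_(0 <= i < N.+1) addable_at a l (nth 0 mu) i).
  rewrite [RHS]exchange_big /=.
  under [RHS]eq_bigr => i _ do rewrite -sum_hook_addable.
  rewrite exchange_big; apply: eq_bigr => lam _.
  exact/hook_countE/le_N.
rewrite -sum1_card -big_split; apply: eq_bigr => mu _ /=.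
rewrite (hook_countE _ _ (le_N _ mu _)) ?leq_addr // addn1.
apply: sum_addable => [j|]; first exact: rows_antitone.
by rewrite row_default ?leq_addr.
Qed.

(** Such a hook alone has [(a + l).+1] boxes. *)
Lemma hook_total_small a l n : n < (a + l).+1 -> hook_total (a, l) n = 0.
Proof.
move=> lt_n; rewrite /hook_total big1 // => lam _.
rewrite (hook_countE _ _ (size_partition lam)) big1 // => i _.
apply/eqP; rewrite eqb0; apply/negP => /(sum_remove_hook (leqnn n)).
by lia.
Qed.

(** * Removing a part *)

Lemma leq_part n (lam : intpartition_of n) k : k \in parts lam -> k <= n.
Proof. by move/leq_mem_sumn; rewrite sumn_partition. Qed.

(** The bijection [mu |-> k :: mu] with its inverse [rem k].  The weight [G] is
    any symmetric function of the parts: a multiplicity for the second sum of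
    the theorem, a bound on the parts for Euler's product. *)
Lemma sum_partitions_with_part k n (G : seq nat -> nat) : 0 < k ->
    (forall s t, perm_eq s t -> G s = G t) ->
  \sum_(lam : intpartition_of (n + k) | k \in parts lam) G lam
  = \sum_(mu : intpartition_of n) G (k :: mu).
Proof.
move=> k_gt0 G_perm.
pose add (mu : intpartition_of n) : intpartition_of (n + k) :=
  partition_of_seq _ (k :: mu).
pose del (lam : intpartition_of (n + k)) : intpartition_of n :=
  partition_of_seq _ (rem k lam).
have filter_id s : 0 \notin s -> [seq x <- s | x != 0] = s.
  by move=> s0; apply/all_filterP/allP => x; apply: contraTneq => ->.
have no0 m (lam : intpartition_of m) : 0 \notin parts lam.
  by have /andP[] := partsP lam.
have perm_add mu : perm_eq (add mu) (k :: mu).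
  rewrite -[k :: mu]filter_id; last first.
    by rewrite inE negb_or no0 eq_sym -lt0n k_gt0.
  by apply: perm_partition_of_seq; rewrite /= sumn_partition addnC.
have perm_del (lam : intpartition_of (n + k)) :
    k \in parts lam -> perm_eq (del lam) (rem k lam).
  move=> k_lam; rewrite -[rem k lam]filter_id; last first.
    by apply: contra (no0 _ lam) => /mem_rem.
  apply: perm_partition_of_seq; apply: (@addIn k).
  by rewrite addnC -[RHS](sumn_partition lam) (perm_sumn (perm_to_rem k_lam)).
have mem_add mu : k \in parts (add mu).
  by rewrite (perm_mem (perm_add mu)) mem_head.
rewrite (reindex_onto add del) => [|lam k_lam]; last first.
  apply/val_inj/perm_partition/(perm_trans (perm_add _)).
  rewrite perm_sym (perm_trans (perm_to_rem k_lam)) // perm_cons perm_sym.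
  exact: perm_del.
apply: eq_big => [mu|mu _]; last exact/G_perm/perm_add.
rewrite mem_add; apply/eqP/val_inj/perm_partition.
apply: perm_trans (perm_del _ (mem_add _)) _.
rewrite -(perm_cons k) (perm_trans _ (perm_add mu)) // perm_sym.
exact/perm_to_rem/mem_add.
Qed.

Definition multiplicity_total k n :=
  \sum_(lam : intpartition_of n) multiplicity k lam.

Lemma multiplicity_total_rec k n : 0 < k ->
  multiplicity_total k (n + k)
  = multiplicity_total k n + #|{: intpartition_of n}|.
Proof.
move=> k_gt0.
rewrite [LHS](bigID (fun lam : intpartition_of _ => k \in parts lam)) /=.
rewrite [X in _ + X]big1 => [|lam /count_memPn //].
rewrite addn0 (sum_partitions_with_part _ (G := count_mem k)) //=.
  by rewrite -sum1_card -big_split; apply: eq_bigr => mu _; rewrite eqxx addnC.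
by move=> s t /permP.
Qed.

Lemma multiplicity_total_small k n : n < k -> multiplicity_total k n = 0.
Proof.
move=> lt_n; apply: big1 => lam _; apply/count_memPn.
by apply: contraL lt_n => /leq_part; rewrite -leqNgt.
Qed.

Definition bounded_partitions m n :=
  \sum_(lam : intpartition_of n) all (geq m) lam.

(** The partitions either have no part [m.+1] at all or have one that can be
    deleted. *)
Lemma bounded_partitions_rec m n :
  bounded_partitions m.+1 (n + m.+1)
  = bounded_partitions m (n + m.+1) + bounded_partitions m.+1 n.
Proof.
rewrite [LHS](bigID (fun lam : intpartition_of _ => m.+1 \in parts lam)) /=.
rewrite [LHS]addnC.
congr (_ + _); last first.
  have G_perm s t : perm_eq s t -> all (geq m.+1) s = all (geq m.+1) t :> nat.
    by move/perm_all ->.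
  rewrite (sum_partitions_with_part n (ltn0Sn m) G_perm).
  by apply: eq_bigr => mu _ /=; rewrite leqnn.
rewrite big_mkcond; apply: eq_bigr => lam _ /=.
case: ifP => [m_lam|/negbFE m_lam]; last first.
  by case: allP => // /(_ _ m_lam); rewrite /= ltnn.
congr nat_of_bool; apply: eq_in_all => x x_lam /=.
have ne_x : x != m.+1.
  by apply: contraNneq m_lam => x_eq; move: x_lam; rewrite x_eq.
by rewrite leq_eqVlt (negPf ne_x).
Qed.

Lemma bounded_partitions_all m n : n <= m ->
  bounded_partitions m n = #|{: intpartition_of n}|.
Proof.
move=> le_n; rewrite -sum1_card; apply: eq_bigr => lam _.
suff -> : all (geq m) lam by [].
by apply/allP => x /leq_part /leq_trans; apply.
Qed.

Lemma bounded_partitions_small m n : n < m.+1 ->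
  bounded_partitions m.+1 n = bounded_partitions m n.
Proof. by move=> lt_n; rewrite !bounded_partitions_all // ltnW. Qed.

Lemma bounded_partitions0 n : bounded_partitions 0 n = (n == 0).
Proof.
case: n => [|n]; last first.
  rewrite [LHS]big1 // => lam _; have := sumn_partition lam.
  case/andP: (partsP lam) => _; case: (parts lam) => //= x s.
  by rewrite inE leqn0 eq_sym; case: (x == 0).
rewrite bounded_partitions_all // eqxx.
apply: (@eq_card1 _ (partition_of_seq 0 [::])) => lam; rewrite !inE.
have nil_of0 (mu : intpartition_of 0) : parts mu = [::].
  by apply/nilP; rewrite /nilp -leqn0 size_partition.
by apply/esym/eqP/val_inj/val_inj; rewrite /= !nil_of0.
Qed.

(** * Power series *)

Local Open Scope ring_scope.

Section PowerSeries.
Variable R : comNzRingType.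
Implicit Types f g : {fps R}.

Lemma fps_coefB f g n : fps_coef (f - g) n = fps_coef f n - fps_coef g n.
Proof. by []. Qed.

Lemma fps_coef_sum (I : Type) (s : seq I) (F : I -> {fps R}) n :
  fps_coef (\sum_(i <- s) F i) n = \sum_(i <- s) fps_coef (F i) n.
Proof. exact: (big_morph (fun f : {fps R} => fps_coef f n)). Qed.

Lemma fps_coef_natl c f n : fps_coef (c%:R * f) n = c%:R * fps_coef f n.
Proof.
rewrite !mulr_natl; elim: c => [|c IHc]; first by rewrite !mulr0n.
by rewrite !mulrS -IHc.
Qed.

Lemma fps_coefXM f n :
  fps_coef (fpsX R * f) n = if n is m.+1 then fps_coef f m else 0.
Proof.
rewrite [LHS]/= big_ord_recl /= mul0r add0r.
case: n => [|n]; first by rewrite big_ord0.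
rewrite big_ord_recl /= mul1r subn1 big1 ?addr0 // => i _.
by rewrite mul0r.
Qed.

Lemma fps_coefXnM k f n :
  fps_coef (fpsX R ^+ k * f) n = if (n < k)%N then 0 else fps_coef f (n - k).
Proof.
elim: k n => [|k IHk] n; first by rewrite expr0 mul1r subn0.
by rewrite exprS -mulrA fps_coefXM; case: n.
Qed.

Lemma fps_coefXn k n : fps_coef (fpsX R ^+ k) n = (n == k)%:R.
Proof.
rewrite -[_ ^+ k]mulr1 fps_coefXnM /=; case: ltngtP => [lt_n|lt_k|->] //;
  last by rewrite subnn.
by rewrite subn_eq0 leqNgt lt_k.
Qed.

Lemma fps_coef_1BXnM k f n :
  fps_coef ((1 - fpsX R ^+ k) * f) n
  = fps_coef f n - (if (n < k)%N then 0 else fps_coef f (n - k)).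
Proof. by rewrite mulrBl mul1r fps_coefB fps_coefXnM. Qed.

(** The inverse is the geometric series, whose coefficients are the indicator
    of the multiples of [k]. *)
Lemma unit_fps_1BXn k : (0 < k)%N -> 1 - fpsX R ^+ k \is a GRing.unit.
Proof.
move=> k_gt0; apply/unitrPr; exists (Fps (fun n => (k %| n)%:R)).
apply/fpsP => n; rewrite fps_coef_1BXnM [RHS]/=.
case: ltnP => [lt_n|le_k] /=.
  rewrite subr0; case: n lt_n => [|n] lt_n; first by rewrite dvdn0.
  by rewrite gtnNdvd.
rewrite dvdn_subl // subrr; case: eqP le_k => // ->.
by rewrite leqNgt k_gt0.
Qed.

Lemma fps_div_geometric k f g : (0 < k)%N ->
    (forall n, fps_coef f n
       = fps_coef g n + (if (n < k)%N then 0 else fps_coef f (n - k))) ->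
  f = g / (1 - fpsX R ^+ k).
Proof.
move=> k_gt0 fE; apply: (canRL (mulrK (unit_fps_1BXn k_gt0))).
by apply/fpsP => n; rewrite mulrC fps_coef_1BXnM {1}fE addrK.
Qed.

(** The recurrence obtained by comparing coefficients in
    [(1 - z ^+ k) * f = z ^+ k * g]. *)
Lemma fps_recurrence k f g : (0 < k)%N ->
    (forall n, (n < k)%N -> fps_coef f n = 0) ->
    (forall n, fps_coef f (n + k) = fps_coef f n + fps_coef g n) ->
  f = fpsX R ^+ k / (1 - fpsX R ^+ k) * g.
Proof.
move=> k_gt0 f_small f_rec; rewrite mulrAC; apply: fps_div_geometric => // n.
rewrite fps_coefXnM; case: ltnP => [/f_small ->|le_k]; first by rewrite addr0.
by rewrite -{1}(subnK le_k) f_rec addrC.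
Qed.

Lemma fps_series1_coef (h : nat -> nat) : h 0%N = 0%N ->
  fps_series1 (fun n => (h n)%:R * fpsX R ^+ n) (Fps (fun n => (h n)%:R)).
Proof.
move=> h0 n; exists n => m le_n /=; rewrite fps_coef_sum.
under eq_bigr => i _ do rewrite fps_coef_natl fps_coefXn.
case: n le_n => [|n] le_n.
  by rewrite h0 big_nat big1 // => -[|i] //; rewrite mulr0.
rewrite (bigD1_seq n.+1) ?iota_uniq ?mem_index_iota //= eqxx mulr1.
by rewrite big1 ?addr0 // => i; rewrite eq_sym => /negPf ->; rewrite mulr0.
Qed.

Lemma fps_family_sum_content (F : intpartition -> nat) :
  fps_family_sum (fun lam => (F lam)%:R * fpsX R ^+ content lam)
    (Fps (fun n => (\sum_(lam : intpartition_of n) F lam)%:R)).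
Proof.
move=> n; exists (map val (enum {: intpartition_of n})) => s s_uniq sub_s /=.
rewrite fps_coef_sum.
transitivity (\sum_(lam <- s | content lam == n) (F lam)%:R : R).
  rewrite [RHS]big_mkcond; apply: eq_bigr => lam _.
  rewrite fps_coef_natl fps_coefXn eq_sym.
  by case: eqP; rewrite ?mulr1 ?mulr0.
have perm_s : perm_eq [seq lam <- s | content lam == n]
                      (map val (enum {: intpartition_of n})).
  apply: uniq_perm; first exact: filter_uniq.
    by rewrite map_inj_uniq ?enum_uniq //; apply: val_inj.
  move=> lam; rewrite mem_filter; apply/andP/mapP => [[lam_n _]|[mu _ ->]].
    by exists (IntPartitionOf lam_n); rewrite ?mem_enum.
  by split; [apply: intpartition_valP | apply/sub_s/map_f; rewrite mem_enum].
by rewrite -[LHS]big_filter (perm_big _ perm_s) big_map big_enum natr_sum.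
Qed.

Definition partition_series : {fps R} :=
  Fps (fun n => #|{: intpartition_of n}|%:R).

(** Multiplication by [1 - z ^+ m.+1] removes the partitions that have a part
    [m.+1], so each new factor raises the bound on the parts by one. *)
Lemma prod_bounded_partitions m :
  \prod_(1 <= i < m.+1) (1 / (1 - fpsX R ^+ i))
  = Fps (fun n => (bounded_partitions m n)%:R).
Proof.
elim: m => [|m IHm].
  by rewrite big_geq //; apply/fpsP => n; rewrite /= bounded_partitions0.
rewrite big_nat_recr //= {}IHm mulrA mulr1; apply/esym.
apply: fps_div_geometric => // n /=; case: ltnP => [lt_n|le_m].
  by rewrite bounded_partitions_small // addr0.
by rewrite -{1 2}(subnK le_m) bounded_partitions_rec natrD.
Qed.

(** Euler's product: the factors up to [m] count the partitions with no part
    larger than [m], which are all partitions of [n] as soon as [n <= m]. *)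
Lemma partition_series_product :
  fps_product1 (fun i => 1 / (1 - fpsX R ^+ i)) partition_series.
Proof.
move=> n; exists n => m le_n.
by rewrite prod_bounded_partitions /= bounded_partitions_all.
Qed.

End PowerSeries.

(** * The generating series of hooks *)

Theorem theorem1p1 (k alpha : nat) (k_ge1 : (1 <= k)%N)
    (alpha_le : (alpha <= k - 1)%N) :
  let z := fpsX int in
  let tau := (alpha, k - 1 - alpha)%N in
  exists2 P : {fps int},
    fps_product1 (fun i => 1 / (1 - z ^+ i)) P &
    let S : {fps int} := z ^+ k / (1 - z ^+ k) * P in
    fps_series1 (fun n => (hook_total tau n)%:R * z ^+ n) S /\
    fps_family_sum
      (fun lam : intpartition => (multiplicity k lam)%:R * z ^+ content lam) S.
Proof.
move=> z tau; exists (partition_series int).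
  exact: partition_series_product.
move=> S; have kE : k = (alpha + (k - 1 - alpha)).+1 by lia.
have hook_rec n : hook_total tau (n + k)
    = (hook_total tau n + #|{: intpartition_of n}|)%N.
  by rewrite {1}kE hook_total_rec.
have hook_small n : (n < k)%N -> hook_total tau n = 0%N.
  by rewrite {1}kE; apply: hook_total_small.
split.
  have <- : Fps (fun n => (hook_total tau n)%:R) = S.
    apply: fps_recurrence => // n /=; first by move/hook_small ->.
    by rewrite hook_rec natrD.
  by apply: fps_series1_coef; apply: hook_small.
have <- : Fps (fun n => (multiplicity_total k n)%:R) = S.
  apply: fps_recurrence => // n /=; first by move/multiplicity_total_small ->.
  by rewrite multiplicity_total_rec // natrD.
exact: fps_family_sum_content.
Qed.
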